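(* Let $\mathbb{F}$ be a field and $n\ge 2$. Then the partition rank of $\det_n$, viewed as an $n$-linear form $(\mathbb{F}^n)^n\to\mathbb{F}$ in the rows of the matrix, satisfies $\mathrm{prk}(\det_n)\ge \log_2(n)+1$.
   Context: For a $d$-linear form $T\colon(\mathbb{F}^n)^d\to\mathbb{F}$ in vector variables $x^{(1)},\dots,x^{(d)}$, the partition rank $\mathrm{prk}(T)$ is the least $r$ such that $T=\sum_{i=1}^r Q_iR_i$, where for each $i$ there is a nonempty proper subset $I_i\subsetneq[d]$ such that $Q_i$ is a multilinear form in the variables $x^{(j)}$, $j\in I_i$, and $R_i$ is a multilinear form in the variables $x^{(j)}$, $j\notin I_i$. *)

(* Defs.v *)
From HB Require Import structures.
From mathcomp Require Import all_boot all_order all_algebra.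
From mathcomp Require Import all_classical all_reals all_analysis.
Set Implicit Arguments.
Unset Strict Implicit.
Unset Printing Implicit Defensive.
Import Order.TTheory GRing.Theory Num.Theory.
Local Open Scope ring_scope.

(* Functions of the d vector variables are taken on the whole space (F^n)^d;
   the first clause says that Q only depends on the variables indexed by I.
   A multilinear form is determined by its values on tuples of basis vectors,
   so identifying forms with functions is harmless over finite fields. *)
Definition multilinear_in (F : fieldType) (n d : nat) (I : {set 'I_d})
    (Q : ('I_d -> 'rV[F]_n) -> F) : Prop :=
  (forall x y : 'I_d -> 'rV[F]_n,
     (forall j, j \in I -> x j = y j) -> Q x = Q y) /\
  (forall (j : 'I_d) (x : 'I_d -> 'rV[F]_n) (a : F) (u v : 'rV[F]_n),
     j \in I ->
     Q [eta x with j |-> a *: u + v] =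
       a * Q [eta x with j |-> u] + Q [eta x with j |-> v]).

Definition partition_decomp (F : fieldType) (n d : nat)
    (T : ('I_d -> 'rV[F]_n) -> F) (r : nat) : Prop :=
  exists (I : 'I_r -> {set 'I_d}) (Q R : 'I_r -> ('I_d -> 'rV[F]_n) -> F),
    (forall i, [/\ I i != finset.set0, I i \proper [set: 'I_d]%SET,
                   multilinear_in (I i) (Q i) &
                   multilinear_in (~: I i)%SET (R i)]) /\
    (forall x, T x = \sum_(i < r) Q i x * R i x).

(* Junk value 0 when T has no decomposition at all, which for a multilinear
   form can only happen when d <= 1. *)
Definition prk (F : fieldType) (n d : nat)
    (T : ('I_d -> 'rV[F]_n) -> F) : nat :=
  xget 0%N [set r | partition_decomp T r /\
                    forall s, partition_decomp T s -> (r <= s)%N]%classic.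

Definition det_form (F : fieldType) (n : nat) (x : 'I_n -> 'rV[F]_n) : F :=
  \det (\matrix_i x i).

Definition log2 (R : realType) (x : R) : R := ln x / ln 2.

(* Main.v *)
(* Suppose [det] is a sum of [r] products with [2 ^ r < 2 * n]. Among all the
   blocks of rows (both sides of every product) take a smallest one, [J]; it has
   at most half of the rows, so there is room to freeze the rows in [J] to linearly
   independent vectors at which every product having [J] as one of its sides
   vanishes. By minimality the remaining products still split the free rows
   properly. Each such step removes at least one product and at most half of the
   free rows, so it can be repeated until no product is left while the frozen
   rows are still independent, contradicting [det <> 0]. *)
Require Import Defs.
From mathcomp Require Import all_boot all_order all_algebra.
From mathcomp Require Import all_classical all_reals all_analysis.
From mathcomp Require Import perm zify.
Import Order.TTheory GRing.Theory Num.Theory.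
Local Open Scope ring_scope.

Section Multilinear.
Context {F : fieldType} {n d : nat}.
Implicit Types (I : {set 'I_d}) (x : 'I_d -> 'rV[F]_n).

Lemma multilinear_in0 I Q j x : @multilinear_in F n d I Q -> j \in I ->
  Q [eta x with j |-> 0] = 0.
Proof.
move=> [_ Qlin] jI; have := Qlin j x 1 0 0 jI.
rewrite scaler0 addr0 mul1r => /eqP.
by rewrite -subr_eq0 opprD addrA subrr sub0r oppr_eq0 => /eqP.
Qed.

Lemma multilinear_in_sum I Q j x (T : Type) (s : seq T) (p : pred T)
    (c : T -> F) (v : T -> 'rV[F]_n) : multilinear_in I Q -> j \in I ->
  Q [eta x with j |-> \sum_(t <- s | p t) c t *: v t] =
    \sum_(t <- s | p t) c t * Q [eta x with j |-> v t].
Proof.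
move=> Qml jI; elim: s => [|t s IHs]; first by rewrite !big_nil (multilinear_in0 _ _ _ _ Qml).
rewrite !big_cons; case: (p t) => //.
by rewrite Qml.2 // IHs.
Qed.

End Multilinear.

Section DetForm.
Context {F : fieldType} {n : nat}.
Implicit Types x : 'I_n -> 'rV[F]_n.

Lemma det_form_multilinear : multilinear_in [set: 'I_n]%SET (@det_form F n).
Proof.
split=> [x y xy|j x a u v _].
  by congr (\det _); apply/matrixP => i k; rewrite !mxE xy ?inE.
rewrite /det_form -[X in _ = _ + X]mul1r; apply: (determinant_multilinear (i0 := j)).
- by apply/rowP => k; rewrite !mxE /= !eqxx !mxE mul1r.
- by apply/matrixP => i k; rewrite !mxE /= eq_sym (negbTE (neq_lift _ _)).
- by apply/matrixP => i k; rewrite !mxE /= eq_sym (negbTE (neq_lift _ _)).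
Qed.

Lemma det_form_perm (s : {perm 'I_n}) x :
  det_form (fun j => x (s j)) = (-1) ^+ s * det_form x.
Proof.
rewrite /det_form -det_perm -det_mulmx -row_permE.
by congr (\det _); apply/matrixP => i j; rewrite !mxE.
Qed.

Lemma det_form_eq_rows (i j : 'I_n) x : i != j -> x i = x j -> det_form x = 0.
Proof.
move=> ij xij; apply: (determinant_alternate ij) => k.
by rewrite !mxE xij.
Qed.

(** After expanding row [j], each term with [k != j] has equal rows [j] and [k], so only the
    coefficient [c j] survives. *)
Lemma det_form_lincomb (W : {set 'I_n}) (j : 'I_n) (c : 'I_n -> F) x : j \in W ->
  det_form [eta x with j |-> \sum_(k in W) c k *: x k] = c j * det_form x.
Proof.
move=> jW; rewrite (multilinear_in_sum _ _ _ _ _ _ _ _ _ det_form_multilinear) ?inE//.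
rewrite (bigD1 j) //= big1 ?addr0 => [|k /andP[_ kj]].
  congr (_ * _); apply: det_form_multilinear.1 => i _ /=.
  by case: eqVneq => // ->.
rewrite (det_form_eq_rows _ _ _ kj) ?mulr0 //=.
by rewrite eqxx (negbTE kj).
Qed.

(* Steinitz exchange: [k] is the index whose vector makes room for [v]; the
   transposition moves it to position [j]. *)
Lemma det_form_exchange (W : {set 'I_n}) (j k : 'I_n) (c : 'I_n -> F) x :
    j \in W -> k \in W -> c k != 0 -> det_form x != 0 ->
  exists y, [/\ det_form y != 0, y j = \sum_(l in W) c l *: x l &
                forall l, l \notin W -> y l = x l].
Proof.
move=> jW kW ck0 x0; set v := \sum_(_ in _) _.
have tW l : (tperm j k l \in W) = (l \in W).
  by case: tpermP => [->|->|//]; rewrite jW kW.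
pose z l := x (tperm j k l).
exists [eta z with j |-> v]; split=> [||l lW] /=.
- have -> : v = \sum_(l in W) c (tperm j k l) *: z l.
    rewrite /v (reindex_inj (@perm_inj _ (tperm j k))) /=.
    by apply: eq_bigl => l; rewrite tW.
  rewrite (det_form_lincomb W j (fun l => c (tperm j k l))) //.
  by rewrite tpermL det_form_perm !mulf_neq0 // signr_eq0.
- by rewrite eqxx.
- rewrite ifN; last by apply: contraNneq lW => ->.
  by rewrite /z tpermD //; apply: contraNneq lW => <-.
Qed.

End DetForm.

(** A matrix with more rows than columns has a nonzero vector in its left kernel; its entries are
    the [c j]. Values of [c] off [W] are junk. *)
Lemma homogeneous_system_nontrivial (F : fieldType) (U T : finType)
    (W : {set U}) (K : {set T}) (f : U -> T -> F) : (#|K| < #|W|)%N ->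
  exists c : U -> F, (exists2 j, j \in W & c j != 0) /\
    forall t, t \in K -> \sum_(j in W) c j * f j t = 0.
Proof.
move=> KW; pose M := \matrix_(a < #|W|, b < #|K|) f (enum_val a) (enum_val b).
have : kermx M != 0.
  rewrite kermx_eq0 /row_free; apply: contraTneq KW => <-.
  by rewrite -leqNgt rank_leq_col.
case/rowV0Pn => u /sub_kermxP uM /rV0Pn[a ua].
have [j0 j0W] : exists j, j \in W by exists (enum_val a); apply: enum_valP.
exists (fun j => u 0 (enum_rank_in j0W j)); split.
  by exists (enum_val a); rewrite ?enum_valP ?enum_valK_in.
move=> t tK; have /rowP/(_ (enum_rank_in tK t)) := uM.
rewrite !mxE => uMt; rewrite big_enum_val -[RHS]uMt.
by apply: eq_bigr => b _; rewrite enum_valK_in !mxE enum_rankK_in.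
Qed.

Lemma double_le_exp2 s : (2 * s <= 2 ^ s)%N.
Proof. by case: s => // s; rewrite expnS leq_mul2l /= ltn_expl. Qed.

(* [I t true] and [I t false] are the two blocks of the [t]-th product; the rows
   outside [A] are frozen to those of the basis [y]. *)
Lemma det_form_sum_card (F : fieldType) (n : nat) (T : finType)
    (I : T -> bool -> {set 'I_n}) (P : T -> bool -> ('I_n -> 'rV[F]_n) -> F)
    (S : {set T}) (A : {set 'I_n}) (y : 'I_n -> 'rV[F]_n) :
    (forall t b, multilinear_in (I t b) (P t b)) ->
    (forall t b, I t (~~ b) = ~: I t b) ->
    det_form y != 0 ->
    (forall t b, t \in S -> I t b :&: A != finset.set0) ->
    (forall x, (forall j, j \notin A -> x j = y j) ->
       det_form x = \sum_(t in S) P t true x * P t false x) ->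
  (2 * #|A| <= 2 ^ #|S|)%N.
Proof.
move=> Pml IC; have [m] := ubnP #|S|.
elim: m S A y => // m IHm S A y /ltnSE Sm y0 IA detE.
have [S0|[t1 t1S]] := set_0Vmem S.
  (* With no product left, the determinant would vanish at [y] itself. *)
  by move: y0; rewrite detE // S0 big_set0 eqxx.
pose size_block (p : T * bool) := #|I p.1 p.2 :&: A|.
have [[t0 b0] /= t0S Jmin] :=
  @arg_minnP _ (t1, true) [pred p | p.1 \in S] size_block t1S.
set J := I t0 b0 :&: A.
have JA : J \subset A by apply: finset.subsetIr.
have AJ : #|A| = (#|J| + #|A :\: J|)%N by rewrite -(cardsID J A) (finset.setIidPr JA).
have J_half : (#|J| <= #|A :\: J|)%N.
  have -> : A :\: J = I t0 (~~ b0) :&: A.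
    by apply/setP => j; rewrite IC !inE; case: (j \in A); rewrite ?andbF ?andbT.
  exact: (Jmin (t0, ~~ b0)).
have Jmin_eq t b : t \in S -> I t b :&: A \subset J -> I t b :&: A = J.
  by move=> tS sub; apply/eqP; rewrite eqEcard sub; apply: (Jmin (t, b)).
have [j0 j0J] : exists j, j \in J by apply/finset.set0Pn; apply: IA.
(* By minimality of [J], these are the products with a block that meets [A] exactly in [J]; [side t]
   will select such a block. *)
pose K := [set t in S | [exists b, I t b :&: A \subset J]]%SET.
have KS : K \subset S by apply/fintype.subsetP => t; rewrite inE => /andP[].
have t0K : t0 \in K.
  by rewrite inE; apply/andP; split=> //; apply/existsP; exists b0.
clearbody J; pose side t := I t true :&: A \subset J.
have side_block t : t \in K -> I t (side t) :&: A = J.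
  rewrite inE => /andP[tS /existsP[b tb]]; apply: Jmin_eq => //.
  case E: (side t); first exact: E.
  by case: b tb => // tb; rewrite /side tb in E.
have S0 : (0 < #|K|)%N by apply/card_gt0P; exists t0.
have cardS : #|S| = (#|K| + #|S :\: K|)%N by rewrite -(cardsID K S) (finset.setIidPr KS).
rewrite leqNgt; apply/negP => A_big.
have {}A_big : (2 ^ #|S|.-1 < #|A|)%N.
  by rewrite -(ltn_pmul2l (isT : 0 < 2)%N) -expnS prednK // cardS addn_gt0 S0.
(* With [s = #|S|]: [2 * #|A :\: J| >= #|A| > 2 ^ s.-1 >= 2 * s.-1], hence
   [#|A :\: J| >= s >= #|K|]. *)
have K_small : (#|K| <= #|A :\: J|)%N.
  by have := double_le_exp2 #|S|.-1; lia.
(* Only row [j0] of [J] gets a new vector, sought in the span of the [y j] with [j] in [W]. The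
   other rows of [J] keep their values from [y], so each [t] in [K] imposes one linear condition:
   [#|K|] equations in at least [#|K| + 1] unknowns. *)
pose W := j0 |: (A :\: J).
have j0W : j0 \in W by rewrite finset.setU11.
have KW : (#|K| < #|W|)%N by rewrite cardsU1 inE j0J add1n ltnS.
pose f j t := P t (side t) [eta y with j0 |-> y j].
have [c [[k kW ck] cf]] := homogeneous_system_nontrivial F _ _ W K f KW.
have [y' [y'0 y'j0 y'W]] := det_form_exchange W j0 k c y j0W kW ck y0.
(* The block [side t] avoids [A :\: J], so its factor sees only frozen rows and takes the value that
   [c] makes zero. *)
have PK0 x t : (forall j, j \notin A :\: J -> x j = y' j) -> t \in K ->
    P t (side t) x = 0.
  move=> xy' tK; have tJ := side_block t tK.
  have j0t : j0 \in I t (side t).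
    by move: j0J; rewrite -tJ inE => /andP[].
  rewrite -(cf t tK) /f -(multilinear_in_sum _ _ _ _ _ _ _ _ _ (Pml t (side t)) j0t).
  apply: (Pml t (side t)).1 => j jt /=.
  have jAJ : j \notin A :\: J.
    by rewrite finset.in_setD -tJ inE jt /=; case: (j \in A).
  rewrite xy' //; case: eqVneq => [->//|jj0].
  by apply: y'W; rewrite finset.in_setU1 negb_or jj0.
have : (2 * #|A :\: J| <= 2 ^ #|S :\: K|)%N.
  apply: (IHm _ _ y') => //.
  - lia.
  (* A block missing [A :\: J] would meet [A] inside [J], which would put [t] in [K]. *)
  - move=> t b; rewrite inE => /andP[tK tS]; apply: contraNneq tK => tb0.
    rewrite inE tS /=; apply/existsP; exists b; apply/fintype.subsetP => j.
    move=> jIA; apply: contraTT isT => jJ; have : j \in I t b :&: (A :\: J).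
      by move: jIA; rewrite !inE (negbTE jJ) => /andP[-> ->].
    by rewrite tb0 inE.
  - move=> x xy'; rewrite detE => [|j jA]; last first.
      have jW : j \notin W.
        rewrite !inE (negbTE jA) andbF orbF; apply: contraNneq jA => ->.
        exact: (fintype.subsetP JA).
      by rewrite xy' ?y'W // inE negb_and jA orbT.
    rewrite (big_setID K) /= [X in X + _]big1 ?add0r // => t.
    rewrite inE => /andP[_ tK]; have := PK0 x t xy' tK.
    by case: (side t) => ->; rewrite ?mul0r ?mulr0.
(* As [K] is nonempty, [2 * #|A :\: J| <= 2 ^ #|S|.-1 < #|A|], against [J_half]. *)
have : (2 ^ #|S :\: K| <= 2 ^ #|S|.-1)%N by rewrite leq_exp2l //; lia.
lia.
Qed.

Lemma partition_decomp_det_form_lower (F : fieldType) (n r : nat) :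
  partition_decomp (@det_form F n) r -> (2 * n <= 2 ^ r)%N.
Proof.
move=> [I [Q [R [IQR detE]]]].
pose I' i (b : bool) := if b then I i else ~: I i.
pose P i (b : bool) := if b then Q i else R i.
(* Initially every row is free, so any basis can serve as [y]; the standard one is taken. *)
have := @det_form_sum_card F n 'I_r I' P [set: 'I_r]%SET [set: 'I_n]%SET
  (fun i => delta_mx 0 i).
rewrite !cardsT !card_ord; apply.
- by move=> i [] /=; case: (IQR i).
- by move=> i [] /=; rewrite ?finset.setCK.
- rewrite /det_form (_ : \matrix_i _ = 1%:M) ?det1 ?oner_neq0 //.
  by apply/matrixP => i j; rewrite !mxE eqxx eq_sym.
- move=> i b _; rewrite finset.setIT; case: (IQR i) => I0 IT _ _.
  case: b => //=; apply: contraTneq IT => IC0.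
  by rewrite -(finset.setCK (I i)) IC0 finset.setC0 fintype.properxx.
- by move=> x _; rewrite detE; apply: eq_bigl => i; rewrite inE.
Qed.

(* Expansion of the determinant along its first row. *)
Lemma partition_decomp_det_form (F : fieldType) (n : nat) : (2 <= n)%N ->
  partition_decomp (@det_form F n) n.
Proof.
case: n => [//|[//|n]] _.
exists (fun=> [set ord0]%SET), (fun i x => x ord0 0 i),
  (fun i x => det_form [eta x with ord0 |-> delta_mx 0 i]); split=> [i|x].
  have detml := @det_form_multilinear F n.+2.
  split.
  - by apply/finset.set0Pn; exists ord0; rewrite inE.
  - by rewrite properEcard finset.subsetT cards1 cardsT card_ord.
  - split=> [x y xy|j x a u v]; first by rewrite xy ?inE.
    by rewrite inE => /eqP-> /=; rewrite !mxE.
  - split=> [x y xy|j x a u v].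
      apply: detml.1 => k _ /=; case: eqVneq => // k0.
      by apply: xy; rewrite !inE.
    rewrite !inE => j0.
    have swap w : det_form [eta [eta x with j |-> w] with ord0 |-> delta_mx 0 i]
        = det_form [eta [eta x with ord0 |-> delta_mx 0 i] with j |-> w].
      apply: detml.1 => k _ /=; case: (eqVneq k j) => [->|//].
      by rewrite (negbTE j0).
    by rewrite !swap detml.2 ?inE.
rewrite -(multilinear_in_sum _ _ _ _ _ _ _ _ _ det_form_multilinear) ?inE //.
apply: det_form_multilinear.1 => k _ /=; case: eqVneq => [->|//].
exact: row_sum_delta.
Qed.

(** One decomposition suffices for a least length to exist, which rules out the default value of
    [xget]. *)
Lemma prk_decomp (F : fieldType) (n d : nat) (T : ('I_d -> 'rV[F]_n) -> F) (r : nat) :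
  partition_decomp T r -> partition_decomp T (prk T).
Proof.
move=> Tr; have Tex : exists r, `[< partition_decomp T r >] by exists r; apply/asboolP.
rewrite /prk; case: xgetP => [_ -> []//|/(_ (ex_minn Tex)) []].
case: ex_minnP => m /asboolP Tm mmin; split=> // s /asboolP; exact: mmin.
Qed.

Theorem theorem3p2 (R : realType) (F : fieldType) (n : nat) (hn : (2 <= n)%N) :
  log2 (n%:R : R) + 1 <= (prk (@det_form F n))%:R.
Proof.
(* The row expansion serves only to show that [prk] is attained. *)
have n2r := partition_decomp_det_form_lower F n _
  (prk_decomp F n n _ n (partition_decomp_det_form F n hn)).
move: (prk _) n2r => r n2r.
have ln2_gt0 : 0 < ln 2 :> R by rewrite ln_gt0 // ltr1n.
have n_gt0 : 0 < n%:R :> R by rewrite ltr0n; lia.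
have -> : log2 n%:R + 1 = (ln n%:R + ln 2) / ln 2 :> R.
  by rewrite mulrDl divff ?lt0r_neq0.
rewrite ler_pdivrMr // -lnM ?posrE // [leRHS]mulr_natl -lnXn //.
by rewrite ler_ln ?posrE ?exprn_gt0 ?mulr_gt0 // mulrC -natrX -natrM ler_nat.
Qed.
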